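(* Let $n\geq 1$ be an integer. For any pre-order $\lesssim$ on $\mathbf{n}=\{1,\dots,n\}$ and any ring $R$, the following conditions are equivalent: (i) $\lesssim$ is an order (i.e. a partial order); (ii) $M_n(\lesssim,R)$ is the intersection of some (one or more) permutation conjugates of the ring of upper triangular matrices in $M_n(R)$; (iii) $M_n(\lesssim,R)$ is the intersection of some (one or more) permutation conjugates of the ring of lower triangular matrices in $M_n(R)$.
   Context: Rings are possibly non-commutative and have a unit element $1$, with $1\neq 0$. Subrings are required to contain the unit element. $M_n(R)$ denotes the ring of $n\times n$ matrices over $R$; a matrix is viewed as a map $A$ on $\mathbf{n}^2$ with entries $A(i,j)$. A pre-order is a reflexive and transitive binary relation; an order (partial order) is an anti-symmetric pre-order. For a pre-order $\lesssim$ on $\mathbf{n}$, the structural matrix ring over $R$ is $$M_n(\lesssim,R)=\{A\in M_n(R): \text{for all } i,j\in\mathbf{n},\ A(i,j)=0 \text{ unless } i\lesssim j\}.$$ Subrings $S$ and $T$ of $M_n(R)$ are permutation conjugates if there is an $n\times n$ permutation matrix $P$ such that $S=\{PAP^{-1}: A\in T\}$. *)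

(* Defs.v *)
From HB Require Import structures.
From mathcomp Require Import all_boot all_order all_fingroup all_algebra.
From mathcomp Require Import boolp classical_sets.

Set Implicit Arguments.
Unset Strict Implicit.
Unset Printing Implicit Defensive.

Import GRing.Theory.
Local Open Scope classical_set_scope.
Local Open Scope ring_scope.

Definition is_preorder (T : Type) (le : rel T) : Prop :=
  reflexive le /\ transitive le.

Definition is_order (T : Type) (le : rel T) : Prop :=
  is_preorder le /\ antisymmetric le.

Definition structural_mx (R : nzRingType) (n : nat) (le : rel 'I_n) :
    set 'M[R]_n :=
  [set A | forall i j, ~~ le i j -> A i j = 0].
Arguments structural_mx R {n} le.

(* [is_trig_mx A] says that [A i j = 0] whenever [i < j]. *)
Definition lower_triangular (R : nzRingType) (n : nat) : set 'M[R]_n :=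
  [set A | is_trig_mx A].
Arguments lower_triangular : clear implicits.

Definition upper_triangular (R : nzRingType) (n : nat) : set 'M[R]_n :=
  [set A | is_trig_mx A^T].
Arguments upper_triangular : clear implicits.

(* [invmx] is only available over commutative rings; over an arbitrary ring,
   [perm_mx s^-1] is the two-sided inverse of [perm_mx s]. *)
Lemma perm_mx_mulV (R : nzRingType) (n : nat) (s : 'S_n) :
  perm_mx s *m perm_mx s^-1 = 1%:M :> 'M[R]_n.
Proof. by rewrite -perm_mxM mulgV perm_mx1. Qed.

Lemma perm_mx_Vmul (R : nzRingType) (n : nat) (s : 'S_n) :
  perm_mx s^-1 *m perm_mx s = 1%:M :> 'M[R]_n.
Proof. by rewrite -perm_mxM mulVg perm_mx1. Qed.

Definition permutation_conjugates (R : nzRingType) (n : nat)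
    (S T : set 'M[R]_n) : Prop :=
  exists s : 'S_n,
    S = [set perm_mx s *m A *m perm_mx s^-1 | A in T].

Definition is_bigcap_of_permutation_conjugates (R : nzRingType) (n : nat)
    (M T : set 'M[R]_n) : Prop :=
  exists F : set (set 'M[R]_n),
    [/\ F !=set0,
        forall S, F S -> permutation_conjugates S T
      & M = \bigcap_(S in F) S].

(* Main.v *)
Require Import Defs.
From mathcomp Require Import all_boot all_order all_fingroup all_algebra.
From mathcomp Require Import boolp classical_sets.

(** A permutation conjugate of the upper triangular ring is the structural
    ring of a total order of the indices, namely the pullback of [<=] along a
    permutation ([conjugate_upperP]); reversing the indices shows that the
    lower triangular ring has the same conjugates ([conjugate_lowerE]).
    Matrix units show that inclusion of structural rings is inclusion of the
    relations ([structural_mxS]), so a structural ring is an intersection of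
    such conjugates when its relation is an intersection of total orders.
    A relation contained in a single total order is already antisymmetric.
    Conversely a finite partial order is the intersection of its linear
    extensions, because for each [x] some linear extension puts below [x]
    every element that is not above [x] ([linear_extension_above]). *)

Set Implicit Arguments.
Unset Strict Implicit.
Unset Printing Implicit Defensive.

Import GRing.Theory.
Local Open Scope classical_set_scope.
Local Open Scope ring_scope.

Section StructuralRings.
Variables (R : nzRingType) (n : nat).
Implicit Types (r le : rel 'I_n) (s : 'S_n) (S : set 'M[R]_n).

(** The matrix unit at [(i, j)] lies in the ring of [r] exactly when [r i j];
    this needs [1 != 0] in [R]. *)
Lemma structural_mxS r r' :
  structural_mx R r `<=` structural_mx R r' -> subrel r r'.
Proof.
move=> sub i j rij; apply: contraT => nr'ij.
have /sub/(_ i j nr'ij) : structural_mx R r (delta_mx i j).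
  move=> k l nrkl; rewrite mxE; case: eqP => //= ek; case: eqP => //= el.
  by rewrite ek el rij in nrkl.
by rewrite mxE !eqxx => /eqP; rewrite oner_eq0.
Qed.

Lemma upper_triangularE :
  upper_triangular R n = structural_mx R (fun i j => (i <= j)%N).
Proof.
apply/seteqP; split=> A /=.
  by move=> /is_trig_mxP At i j; rewrite -ltnNge => /At; rewrite mxE.
by move=> Ar; apply/is_trig_mxP => i j ij; rewrite mxE Ar // -ltnNge.
Qed.

Lemma lower_triangularE :
  lower_triangular R n = structural_mx R (fun i j => (j <= i)%N).
Proof.
apply/seteqP; split=> A /=.
  by move=> /is_trig_mxP At i j; rewrite -ltnNge => /At.
by move=> Ar; apply/is_trig_mxP => i j ij; rewrite Ar // -ltnNge.
Qed.

Lemma perm_mx_conjE s (A : 'M[R]_n) i j :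
  (perm_mx s *m A *m perm_mx s^-1) i j = A (s i) (s j).
Proof. by rewrite -col_permE -row_permE !mxE. Qed.

Lemma conjugate_structural_mx s r :
  [set perm_mx s *m A *m perm_mx s^-1 | A in structural_mx R r]
    = structural_mx R (relpre s r).
Proof.
apply/seteqP; split=> [_ [A Ar <-] i j nr|B Br].
  by rewrite perm_mx_conjE Ar.
exists (perm_mx s^-1 *m B *m perm_mx s^-1^-1).
  by move=> i j nr; rewrite perm_mx_conjE Br //= !permKV.
by apply/matrixP => i j; rewrite !perm_mx_conjE !permK.
Qed.

Lemma conjugate_upperP S :
  permutation_conjugates S (upper_triangular R n) <->
  exists s, S = structural_mx R (fun i j => (s i <= s j)%N).
Proof.
by split=> -[s ->]; exists s; rewrite upper_triangularE conjugate_structural_mx.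
Qed.

Lemma conjugate_lowerP S :
  permutation_conjugates S (lower_triangular R n) <->
  exists s, S = structural_mx R (fun i j => (s j <= s i)%N).
Proof.
by split=> -[s ->]; exists s; rewrite lower_triangularE conjugate_structural_mx.
Qed.

Lemma conjugate_lowerE S :
  permutation_conjugates S (lower_triangular R n) <->
  permutation_conjugates S (upper_triangular R n).
Proof.
rewrite conjugate_lowerP conjugate_upperP.
have rev_le (i j : 'I_n) : (rev_ord i <= rev_ord j)%N = (j <= i)%N.
  by rewrite leq_sub2lE.
by split=> -[s ->]; exists (s * perm rev_ord_inj)%g; congr structural_mx;
  apply/funext => i; apply/funext => j; rewrite !permM !permE rev_le.
Qed.

Lemma bigcap_conjugates_lowerE S :
  is_bigcap_of_permutation_conjugates S (lower_triangular R n) <->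
  is_bigcap_of_permutation_conjugates S (upper_triangular R n).
Proof.
by split=> -[F [F0 FP ->]]; exists F; split=> // S' /FP /conjugate_lowerE.
Qed.

End StructuralRings.

(** Rank the indices by [f], breaking ties by the indices themselves. *)
Lemma perm_of_keys n (f : 'I_n -> nat) :
  exists s : 'S_n, forall a b, (f a < f b)%N -> (s a < s b)%N.
Proof.
pose g (a : 'I_n) := (f a * n + a)%N.
have g_lt a b : (f a < f b)%N -> (g a < g b)%N.
  move=> fab; rewrite /g (@leq_trans ((f a).+1 * n)%N) //.
    by rewrite mulSn addnC ltn_add2r.
  by rewrite (leq_trans _ (leq_addr _ _)) // leq_mul2r fab orbT.
have g_inj : injective g.
  move=> a b gab; case: (ltngtP (f a) (f b)) => [/g_lt|/g_lt|fab].
  - by rewrite gab ltnn.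
  - by rewrite gab ltnn.
  - by apply/val_inj/eqP; rewrite -(eqn_add2l (f a * n)) {2}fab; apply/eqP.
pose below a := [set c | (g c < g a)%N]%SET.
have below_ltn a : (#|below a| < n)%N.
  rewrite -[X in (_ < X)%N]card_ord; apply/proper_card/properP.
  by split; [exact: subset_predT | exists a; rewrite // inE ltnn].
pose rank a := Ordinal (below_ltn a).
have rank_lt a b : (g a < g b)%N -> (rank a < rank b)%N.
  move=> gab; apply: (@proper_card _ (below a) (below b)).
  apply/properP; split.
    by apply/fintype.subsetP => c; rewrite !inE => /ltn_trans; apply.
  by exists a; rewrite !inE ?ltnn.
have rank_inj : injective rank.
  move=> a b rab; apply: g_inj.
  by case: (ltngtP (g a) (g b)) => // /rank_lt; rewrite rab ltnn.
by exists (perm rank_inj) => a b /g_lt/rank_lt; rewrite !permE.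
Qed.

(** The number of elements below [a] is a strictly increasing key. Adding
    [n.+1], which exceeds every such number, to the keys of the elements above
    [x] keeps the key strictly increasing, since these elements form an
    up-set, and moves [x] past everything outside that up-set. *)
Lemma linear_extension_above n (le : rel 'I_n) (x : 'I_n) : is_order le ->
  exists s : 'S_n, (forall a b, le a b -> (s a <= s b)%N) /\
                   (forall y, ~~ le x y -> (s y < s x)%N).
Proof.
move=> [[le_refl le_trans] le_anti].
pose down a := [set c | le c a]%SET.
have [s s_lt] := perm_of_keys (fun a => le x a * n.+1 + #|down a|)%N.
exists s; split=> [a b le_ab|y nle_xy]; last first.
  apply: s_lt; rewrite (negPf nle_xy) le_refl mul0n mul1n add0n addSn ltnS.
  by rewrite (leq_trans (max_card _)) // card_ord leq_addr.
have [->//|ab] := eqVneq a b; apply/ltnW/s_lt.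
rewrite -addnS leq_add //.
  rewrite leq_mul2r; case: (boolP (le x a)) => // le_xa.
  by rewrite (le_trans _ _ _ le_xa le_ab) orbT.
apply: (@proper_card _ (down a) (down b)); apply/properP; split.
  by apply/fintype.subsetP => c; rewrite !inE => /le_trans; apply.
exists b; rewrite !inE ?le_refl //.
by apply: contra ab => le_ba; rewrite (le_anti a b) // le_ab le_ba.
Qed.

(** The family of all conjugates that contain the structural ring suffices:
    for [A] in their intersection and [i], the linear extension obtained from
    [i] forces [A i j = 0] for every [j] not above [i]. *)
Lemma order_bigcap_upper n (n_gt0 : (0 < n)%N) (le : rel 'I_n)
    (R : nzRingType) : is_order le ->
  is_bigcap_of_permutation_conjugates
    (structural_mx R le) (upper_triangular R n).
Proof.
move=> le_order.
have sub_ext (s : 'S_n) : (forall a b, le a b -> (s a <= s b)%N) ->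
    structural_mx R le `<=` structural_mx R (fun i j => (s i <= s j)%N).
  by move=> s_le A Ale i j nsij; apply/Ale/(contra _ nsij)/s_le.
exists [set S | permutation_conjugates S (upper_triangular R n) /\
                structural_mx R le `<=` S]; split=> [|S []//|].
  have [s [/sub_ext s_le _]] := linear_extension_above (Ordinal n_gt0) le_order.
  exists (structural_mx R (fun i j => (s i <= s j)%N)).
  by split=> //; apply/conjugate_upperP; exists s.
apply/seteqP; split=> [A Ale S [_]|A AF i j nle_ij]; first exact.
have [s [/sub_ext s_le s_i]] := linear_extension_above i le_order.
apply: (AF (structural_mx R (fun i j => (s i <= s j)%N))).
  by split=> //; apply/conjugate_upperP; exists s.
by rewrite -ltnNge s_i.
Qed.

(** The intersection being over a nonempty family, its relation is contained
    in at least one total order and inherits antisymmetry from it. *)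
Lemma bigcap_upper_antisymmetric n (le : rel 'I_n) (R : nzRingType) :
  is_bigcap_of_permutation_conjugates
    (structural_mx R le) (upper_triangular R n) ->
  antisymmetric le.
Proof.
move=> [F [[S FS] FP le_cap]] i j /andP[le_ij le_ji].
have /conjugate_upperP[s S_eq] := FP _ FS.
have s_le : subrel le (fun i j => (s i <= s j)%N).
  by apply: (@structural_mxS R); rewrite le_cap -S_eq => A; apply.
by apply/(@perm_inj _ s)/val_inj/anti_leq; rewrite !s_le.
Qed.

Theorem proposition3 (n : nat) (n_gt0 : (0 < n)%N) (le : rel 'I_n)
    (le_preorder : is_preorder le) (R : nzRingType) :
  [<-> is_order le;
       is_bigcap_of_permutation_conjugates
         (structural_mx R le) (upper_triangular R n);
       is_bigcap_of_permutation_conjugates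
         (structural_mx R le) (lower_triangular R n)].
Proof.
tfae.
- exact: order_bigcap_upper.
- by rewrite bigcap_conjugates_lowerE.
- by rewrite bigcap_conjugates_lowerE => /bigcap_upper_antisymmetric.
Qed.
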